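(* Let $\Sigma\in\mathbb{R}^{n\times n}$ be symmetric positive definite, $K\in\mathbb{R}^{n\times r}$, $a_1,\dots,a_m\in\mathbb{R}^n$, $\sigma>0$, $N$ a positive integer, $\sigma_N^2:=\sigma^2/N$, and let $A=[a_1,\dots,a_m]^T\in\mathbb{R}^{m\times n}$ be the matrix with rows $a_i^T$. Consider the optimization problem $$\rho:=\min_{X\in\mathbb{R}^{r\times m}}\ \|(XA-K^T)\Sigma^{1/2}\|_F^2+\sigma_N^2\Big(\sum_{i=1}^m\|x_i\|\Big)^2,$$ where $x_i\in\mathbb{R}^r$ denotes the $i$th column of $X$. Then $\rho$ is equal to the optimal value of the Bayes $A_K$-optimal design problem $$\min_{w\in\Delta}\ \operatorname{trace}\Big(K^T\Big(\Sigma^{-1}+\frac{N}{\sigma^2}\sum_{i=1}^m w_i a_i a_i^T\Big)^{-1}K\Big).$$ Moreover, if $X^*=[x_1^*,\dots,x_m^*]$ is a minimizer of the first problem with $\sum_{j=1}^m\|x_j^*\|>0$, then the design $w^*$ defined by $w_i^*=\dfrac{\|x_i^*\|}{\sum_{j=1}^m\|x_j^*\|}$ for $i=1,\dots,m$ is Bayes $A_K$-optimal.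
   Context: $\Delta:=\{w\in\mathbb{R}^m:\ w\ge 0,\ \sum_{i=1}^m w_i=1\}$ is the probability simplex. $\|\cdot\|$ is the Euclidean norm of a vector and $\|\cdot\|_F$ the Frobenius norm of a matrix. $\Sigma^{1/2}$ is the symmetric positive definite square root of $\Sigma$. A design $w^*\in\Delta$ is called Bayes $A_K$-optimal if it is a minimizer over $\Delta$ of $w\mapsto\operatorname{trace}\big(K^T(\Sigma^{-1}+\frac{N}{\sigma^2}\sum_{i} w_i a_i a_i^T)^{-1}K\big)$. *)

(* Defs.v *)
From mathcomp Require Import all_boot all_order all_algebra.
From mathcomp Require Import boolp classical_sets reals.

Set Implicit Arguments.
Unset Strict Implicit.
Unset Printing Implicit Defensive.

Import Order.TTheory GRing.Theory Num.Theory.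
Local Open Scope classical_set_scope.
Local Open Scope ring_scope.

Definition is_minimizer (R : realType) (T : Type) (D : set T) (f : T -> R)
    (x : T) : Prop :=
  D x /\ forall y, D y -> f x <= f y.

(* The minimum of f over D is attained, and is equal to v. *)
Definition is_min_value (R : realType) (T : Type) (D : set T) (f : T -> R)
    (v : R) : Prop :=
  exists x, is_minimizer D f x /\ f x = v.

(* The norm `|_| that MathComp-Analysis puts on matrices is the maximum norm,
   so the Euclidean and Frobenius norms are defined here. *)
Definition enorm (R : realType) (n : nat) (x : 'cV[R]_n) : R :=
  Num.sqrt (\sum_i x i 0 ^+ 2).

Definition fnorm (R : realType) (p q : nat) (M : 'M[R]_(p, q)) : R :=
  Num.sqrt (\sum_i \sum_j M i j ^+ 2).

Definition sympd (R : realType) (n : nat) (S : 'M[R]_n) : Prop :=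
  S^T = S /\ forall x : 'cV[R]_n, x != 0 -> 0 < (x^T *m S *m x) 0 0.

(* For a symmetric positive definite S, exactly one matrix satisfies the
   predicate below; the default value 0 is only used for other S. *)
Definition sqrtmx (R : realType) (n : nat) (S : 'M[R]_n) : 'M[R]_n :=
  xget 0 [set Q : 'M[R]_n | sympd Q /\ Q *m Q = S].

Definition simplex (R : realType) (m : nat) : set 'rV[R]_m :=
  [set w | (forall i, 0 <= w 0 i) /\ \sum_i w 0 i = 1].
Arguments simplex : clear implicits.

Definition design_mx (R : realType) (m n : nat) (a : 'I_m -> 'cV[R]_n) :
    'M[R]_(m, n) :=
  \matrix_(i, j) a i j 0.

Definition lasso_obj (R : realType) (m n r N : nat) (Sigma : 'M[R]_n)
    (K : 'M[R]_(n, r)) (a : 'I_m -> 'cV[R]_n) (sigma : R)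
    (X : 'M[R]_(r, m)) : R :=
  fnorm ((X *m design_mx a - K^T) *m sqrtmx Sigma) ^+ 2
  + (sigma ^+ 2 / N%:R) * (\sum_i enorm (col i X)) ^+ 2.

(* invmx is the identity on singular matrices, but both inverses below are
   genuine when Sigma is positive definite and w lies in the simplex. *)
Definition bayes_obj (R : realType) (m n r N : nat) (Sigma : 'M[R]_n)
    (K : 'M[R]_(n, r)) (a : 'I_m -> 'cV[R]_n) (sigma : R)
    (w : 'rV[R]_m) : R :=
  \tr (K^T *m invmx (invmx Sigma + (N%:R / sigma ^+ 2) *:
                       \sum_i w 0 i *: (a i *m (a i)^T)) *m K).

Definition bayes_optimal (R : realType) (m n r N : nat) (Sigma : 'M[R]_n)
    (K : 'M[R]_(n, r)) (a : 'I_m -> 'cV[R]_n) (sigma : R)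
    (w : 'rV[R]_m) : Prop :=
  is_minimizer (simplex R m) (bayes_obj N Sigma K a sigma) w.

(* Main.v *)
Require Import Defs.
From mathcomp Require Import all_boot all_order all_algebra.
From mathcomp Require Import boolp classical_sets reals.
From mathcomp Require Import topology normedtype derive realfun.
From mathcomp.real_closed Require Import complex.
From mathcomp Require Import ring lra.

Set Implicit Arguments.
Unset Strict Implicit.
Unset Printing Implicit Defensive.

Import Order.TTheory GRing.Theory Num.Theory.
Import numFieldNormedType.Exports.
Local Open Scope classical_set_scope.
Local Open Scope ring_scope.

(** Write s for the regularization weight sigma^2 / N, let L be the sum of the
    Euclidean norms of the columns x_i of X, and let
    M(w) = Sigma^-1 + s^-1 * sum_i w_i a_i a_i^T, so that the Bayes objective
    is tr(K^T M(w)^-1 K).  The equality of the two optimal values rests on two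
    facts.

    The squared sum of norms is a minimum over the simplex: by the
    Cauchy-Schwarz inequality, L^2 <= sum_i |x_i|^2 / w_i, with equality when
    w is proportional to the norms |x_i|.  And for a fixed w the problem
    min_X |(X A - K^T) Sigma^(1/2)|_F^2 + s * sum_i |x_i|^2 / w_i is a ridge
    regression, whose value is tr(K^T M(w)^-1 K).

    In the proof both facts are read off the matrix Y = M(w)^-1 K, which has
    the advantage that weights w_i = 0 need no convention for |x_i|^2 / w_i.
    In [bayes_le_lasso], w is proportional to the column norms of X, and the
    concave dual function 2 tr(K^T Y) - tr(Y^T M(w) Y), whose value at this Y
    is the Bayes objective, is bounded by the lasso objective of X: split K^T into K^T - X A
    and X A, and apply a Young inequality to each part ([mxtrace_young],
    [dot_young]).  In [lasso_le_bayes], w is arbitrary and the ridge solution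
    x_i = (w_i / s) Y^T a_i has a lasso objective at most the Bayes objective
    of w, by convexity of the square ([sqr_mean_le]).

    Hence a minimizer X of the lasso objective, together with a design w
    proportional to its column norms, satisfies
    bayes w <= lasso X <= lasso X' <= bayes w' for every design w' and the X'
    attached to it, which is the theorem ([bayes_optimal_of_lasso]).  If X = 0,
    every design is proportional to the column norms.  The lasso objective has
    a minimizer because it is continuous and its penalty bounds every entry of
    X ([lasso_minimizer_exists]).

    The matrix Sigma^(1/2) enters only through tr(E Sigma E^T), but this needs
    a positive definite square root to exist ([sympd_sqrt_exists]); it comes
    from the diagonalization of a real symmetric matrix. *)

(** * Euclidean norm *)

Lemma sqr_enormE (R : realType) n (x : 'cV[R]_n) :
  enorm x ^+ 2 = (x^T *m x) 0 0.
Proof.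
rewrite /enorm sqr_sqrtr; last by apply: sumr_ge0 => i _; exact: sqr_ge0.
by rewrite mxE; apply: eq_bigr => i _; rewrite mxE expr2.
Qed.

Lemma enorm_ge0 (R : realType) n (x : 'cV[R]_n) : 0 <= enorm x.
Proof. exact: sqrtr_ge0. Qed.

Lemma enorm_gt0 (R : realType) n (x : 'cV[R]_n) : x != 0 -> 0 < enorm x.
Proof.
move=> /cV0Pn[i xi_neq0]; rewrite sqrtr_gt0 (bigD1 i) //= ltr_pwDl //.
  by rewrite exprn_even_gt0.
by apply: sumr_ge0 => j _; exact: sqr_ge0.
Qed.

Lemma enorm_eq0 (R : realType) n (x : 'cV[R]_n) : enorm x = 0 -> x = 0.
Proof. by have [//|/enorm_gt0/gt_eqF/eqP] := eqVneq x 0. Qed.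

Lemma enormZ (R : realType) n (c : R) (x : 'cV[R]_n) :
  0 <= c -> enorm (c *: x) = c * enorm x.
Proof.
move=> c_ge0; rewrite /enorm.
under eq_bigr do rewrite mxE exprMn.
by rewrite -mulr_sumr sqrtrM ?sqr_ge0 // sqrtr_sqr ger0_norm.
Qed.

(** Complete the square in each coordinate.  In place of the Cauchy-Schwarz
    inequality, this form is used with c = s / w_i: when |x| = L w_i, its two
    terms are the i-th shares of the penalty s L^2 and of the trace of
    Y^T M(w) Y. *)
Lemma dot_young (R : realType) r (x z : 'cV[R]_r) (c : R) :
  0 < c -> 2 * (x^T *m z) 0 0 <= c * enorm x ^+ 2 + c^-1 * enorm z ^+ 2.
Proof.
move=> c_gt0; rewrite mxE /enorm !sqr_sqrtr; try by
  apply: sumr_ge0 => i _; exact: sqr_ge0.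
rewrite !mulr_sumr -big_split; apply: ler_sum => i _ /=; rewrite mxE.
rewrite -subr_ge0.
have -> : c * x i 0 ^+ 2 + c^-1 * z i 0 ^+ 2 - 2 * (x i 0 * z i 0) =
   c * (x i 0 - c^-1 * z i 0) ^+ 2 by field; rewrite gt_eqF.
by rewrite mulr_ge0 ?sqr_ge0 ?ltW.
Qed.

(** Jensen's inequality for the square: the variance of t under the weights w
    is nonnegative. *)
Lemma sqr_mean_le (R : realType) m (w t : 'I_m -> R) :
  (forall i, 0 <= w i) -> \sum_i w i = 1 ->
  (\sum_i w i * t i) ^+ 2 <= \sum_i w i * t i ^+ 2.
Proof.
move=> w_ge0 w_sum1; set mu := \sum_i w i * t i.
have : 0 <= \sum_i w i * (t i - mu) ^+ 2.
  by apply: sumr_ge0 => i _; rewrite mulr_ge0 ?sqr_ge0.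
rewrite (eq_bigr (fun i => w i * t i ^+ 2 - (2 * mu) * (w i * t i)
                            + mu ^+ 2 * w i)); last by move=> i _; ring.
rewrite big_split sumrB /= -!mulr_sumr w_sum1 -/mu.
by nra.
Qed.

(** * Positive definite matrices *)

Lemma sympd_trmx_mul (R : realType) n (T : 'M[R]_n) :
  T \in unitmx -> sympd (T^T *m T).
Proof.
move=> T_unit; split=> [|x x_neq0]; first by rewrite trmx_mul trmxK.
have Tx_neq0 : T *m x != 0.
  by apply: contra_neq x_neq0 => Tx0; rewrite -(mulKmx T_unit x) Tx0 mulmx0.
by rewrite mulmxA -trmx_mul -mulmxA -sqr_enormE exprn_gt0 // enorm_gt0.
Qed.

Lemma sympd_unitmx (R : realType) n (S : 'M[R]_n) : sympd S -> S \in unitmx.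
Proof.
move=> [_ S_gt0]; rewrite unitmxE unitfE; apply/negP => /det0P [v v_neq0 vS].
have := S_gt0 v^T; rewrite trmxK vS mul0mx mxE ltxx trmx_eq0 v_neq0.
by move=> /(_ isT).
Qed.

Lemma sympd_invmx (R : realType) n (S : 'M[R]_n) : sympd S -> sympd (invmx S).
Proof.
move=> S_pd; have S_unit := sympd_unitmx S_pd; have [S_sym S_gt0] := S_pd.
split=> [|x x_neq0]; first by rewrite trmx_inv S_sym.
have y_neq0 : invmx S *m x != 0.
  by apply: contra_neq x_neq0 => y0; rewrite -(mulKVmx S_unit x) y0 mulmx0.
have := S_gt0 _ y_neq0.
by rewrite trmx_mul trmx_inv S_sym -!mulmxA mulKVmx // mulmxA.
Qed.

(** * Square root of a positive definite matrix *)

(** The spectral theorem over R[i] gives a complex change of basis to a real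
    diagonal matrix; two real matrices that are similar over R[i] are similar
    over R.  The real basis P so obtained need not be orthogonal. *)
Lemma symmetric_diagonalizable (R : realType) n (S : 'M[R]_n) :
  S^T = S ->
  exists2 P : 'M[R]_n, P \in unitmx & exists d, S = invmx P *m diag_mx d *m P.
Proof.
move=> Ssym.
pose toC : {rmorphism R -> complex R} := real_complex R.
have toC_real x : toC x \is Num.real by apply/complex_realP; exists x.
have toC_realmx p q (M : 'M[R]_(p, q)) : map_mx toC M \is a mxOver Num.real.
  by apply/mxOverP => i j; rewrite mxE.
have of_real p q (M : 'M[complex R]_(p, q)) :
    M \is a mxOver Num.real -> exists M', M = map_mx toC M'.
  move=> Mreal; exists (map_mx (@complex.Re R) M).
  apply/matrixP => i j; rewrite !mxE.
  by have /mxOverP/(_ i j)/RRe_real := Mreal.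
pose A := map_mx toC S.
have A_herm : A \is hermsymmx.
  apply: realsym_hermsym (toC_realmx _ _ _).
  by apply/is_hermitianmxP; rewrite scale1r map_mx_id // map_trmx Ssym.
have [d A_d] := of_real _ _ _ (hermitian_spectral_diag_real A_herm).
have P_unit := spectral_unit A.
have A_sim : similar_in unitmx A (diag_mx (spectral_diag A)).
  exists (spectralmx A) => //; apply/(similarP P_unit).
  rewrite {2}(orthomx_spectralP (hermitian_normalmx A_herm)).
  by rewrite -!mulmxA mulKVmx.
rewrite A_d -map_diag_mx in A_sim.
have [Q /andP[Qreal Qunit] /(similarP Qunit) QA] :=
  real_similar A_sim (toC_realmx _ _ _) (toC_realmx _ _ _).
have [P QP] := of_real _ _ _ Qreal.
move: Qunit QA; rewrite QP map_unitmx -!map_mxM => Pu /map_mx_inj PS.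
exists P => //; exists d.
by rewrite -mulmxA -PS mulKmx.
Qed.

(** Applying a function g to the eigenvalues in the basis P gives matrices
    f g with f g * f h = f (g * h).  They are symmetric although P need not be
    orthogonal: symmetry of S means that the Gram matrix P P^T commutes with
    diag d, hence also with diag (g d).  Taking g to be the fourth root makes
    the square root f g * f g visibly of the form T^T T, hence positive
    definite. *)
Lemma sympd_sqrt_exists (R : realType) n (S : 'M[R]_n) :
  sympd S -> exists Q, sympd Q /\ Q *m Q = S.
Proof.
move=> S_pd; have [S_sym S_gt0] := S_pd.
have [P P_unit [d S_eq]] := symmetric_diagonalizable S_sym.
have PS : P *m S = diag_mx d *m P by rewrite S_eq -!mulmxA mulKVmx.
(* The i-th row of P is an eigenvector of S with eigenvalue d 0 i. *)
have d_gt0 i : 0 < d 0 i.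
  pose p := row i P.
  have p_neq0 : p^T != 0.
    rewrite trmx_eq0 /p rowE; apply/eqP => e0.
    have /rowP/(_ i) : delta_mx 0 i = 0 :> 'rV[R]_n.
      by rewrite -(mulmxK P_unit (delta_mx 0 i)) e0 mul0mx.
    by rewrite !mxE !eqxx => /eqP; rewrite oner_eq0.
  have pS : p *m S = d 0 i *: p.
    by rewrite /p -row_mul PS row_mul row_diag_mx -scalemxAl -rowE.
  have := S_gt0 _ p_neq0; rewrite trmxK pS -scalemxAl mxE.
  rewrite -{1}[p]trmxK -sqr_enormE pmulr_lgt0 // exprn_gt0 //.
  exact: enorm_gt0.
pose f g : 'M[R]_n := invmx P *m diag_mx (map_mx g d) *m P.
have fM g h : f g *m f h = f (fun x => g x * h x).
  rewrite /f !mulmxA mulmxK // -(mulmxA _ (diag_mx _) (diag_mx _)) mulmx_diag.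
  congr (_ *m diag_mx _ *m _).
  by apply/rowP => i; rewrite !mxE.
have f_sym g : (f g)^T = f g.
  have G_comm i j : (d 0 i - d 0 j) * (P *m P^T) i j = 0.
    have : P *m S *m P^T = (P *m S *m P^T)^T.
      by rewrite !trmx_mul trmxK S_sym mulmxA.
    rewrite PS -mulmxA trmx_mul tr_diag_mx trmx_mul trmxK.
    move=> /matrixP/(_ i j); rewrite mul_diag_mx mul_mx_diag mxE [RHS]mxE.
    by rewrite mulrBl [d 0 j * _]mulrC => ->; rewrite subrr.
  have gG : diag_mx (map_mx g d) *m (P *m P^T) =
            (P *m P^T) *m diag_mx (map_mx g d).
    rewrite mul_diag_mx mul_mx_diag.
    apply/matrixP => i j; rewrite mxE [RHS]mxE ![map_mx _ _ _ _]mxE mulrC.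
    have /eqP := G_comm i j.
    rewrite mulf_eq0 subr_eq0 => /orP[/eqP ->//|/eqP ->].
    by rewrite !mul0r.
  have PT_unit : P^T \in unitmx by rewrite unitmx_tr.
  rewrite /f !trmx_mul tr_diag_mx trmx_inv; apply: (can_inj (mulmxK PT_unit)).
  by rewrite mulmxA mulmxKV // -[RHS]mulmxA -mulmxA gG -!mulmxA mulKmx.
pose root4 x : R := Num.sqrt (Num.sqrt x).
have f_eqS g : (forall x, 0 < x -> g x = x) -> f g = S.
  move=> g_id; rewrite /f S_eq; congr (_ *m diag_mx _ *m _).
  by apply/rowP => i; rewrite mxE g_id.
have root4_sqr x : root4 x * root4 x = Num.sqrt x.
  by rewrite -expr2 sqr_sqrtr ?sqrtr_ge0.
have fS : (f root4 *m f root4) *m (f root4 *m f root4) = S.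
  rewrite !fM f_eqS // => x x_gt0.
  by rewrite !root4_sqr -expr2 sqr_sqrtr ?ltW.
exists (f root4 *m f root4); split=> //.
rewrite -{1}f_sym; apply: sympd_trmx_mul.
have := sympd_unitmx S_pd; rewrite -fS -mulmxA unitmx_mul.
by case/andP.
Qed.

Lemma sqrtmxP (R : realType) n (S : 'M[R]_n) :
  sympd S -> sympd (sqrtmx S) /\ sqrtmx S *m sqrtmx S = S.
Proof. by move=> /sympd_sqrt_exists; exact: xgetPex. Qed.

(** * Traces of quadratic forms *)

Lemma sqr_fnormE (R : realType) p q (M : 'M[R]_(p, q)) :
  fnorm M ^+ 2 = \tr (M *m M^T).
Proof.
rewrite /fnorm sqr_sqrtr; last first.
  by apply: sumr_ge0 => i _; apply: sumr_ge0 => j _; exact: sqr_ge0.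
apply: eq_bigr => i _; rewrite mxE; apply: eq_bigr => j _.
by rewrite mxE expr2.
Qed.

Lemma sqr_fnorm_sqrtmx (R : realType) n r (S : 'M[R]_n) (E : 'M[R]_(r, n)) :
  sympd S -> fnorm (E *m sqrtmx S) ^+ 2 = \tr (E *m S *m E^T).
Proof.
move=> /sqrtmxP[[Q_sym _] QQ].
by rewrite sqr_fnormE trmx_mul Q_sym -mulmxA (mulmxA (sqrtmx S)) QQ mulmxA.
Qed.

Lemma mxtrace_quad (R : realType) n r (S : 'M[R]_n) (Y : 'M[R]_(n, r)) :
  \tr (Y^T *m S *m Y) = \sum_j ((col j Y)^T *m S *m col j Y) 0 0.
Proof.
apply: eq_bigr => j _.
by rewrite tr_col -row_mul mxE [RHS]mxE; apply: eq_bigr => k _; rewrite !mxE.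
Qed.

Lemma mxtrace_quad_ge0 (R : realType) n r (S : 'M[R]_n) (Y : 'M[R]_(n, r)) :
  sympd S -> 0 <= \tr (Y^T *m S *m Y).
Proof.
move=> [_ S_gt0]; rewrite mxtrace_quad; apply: sumr_ge0 => j _.
have [->|/S_gt0/ltW//] := eqVneq (col j Y) 0.
by rewrite mulmx0 mxE.
Qed.

(** The Fenchel-Young inequality for the quadratic form of S and its conjugate,
    the form of S^-1, summed over the columns of Y: expand the square of
    E^T - S^-1 Y in the inner product of S. *)
Lemma mxtrace_young (R : realType) n r (S : 'M[R]_n)
    (E : 'M[R]_(r, n)) (Y : 'M[R]_(n, r)) :
  sympd S ->
  2 * \tr (E *m Y) <= \tr (E *m S *m E^T) + \tr (Y^T *m invmx S *m Y).
Proof.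
move=> S_pd; have S_unit := sympd_unitmx S_pd; have [S_sym _] := S_pd.
have := mxtrace_quad_ge0 (E^T - invmx S *m Y) S_pd.
have tE : (E^T - invmx S *m Y)^T = E - Y^T *m invmx S.
  by rewrite linearB /= trmxK trmx_mul trmx_inv S_sym.
rewrite tE !mulmxBl !mulmxBr mulmxKV // -!(mulmxA E) mulKVmx // mulmxA.
rewrite !raddfB /= -(mxtrace_tr (Y^T *m E^T)) trmx_mul !trmxK !mulmxA.
by lra.
Qed.

(** * Information matrix of a design *)

Definition moment_mx (R : realType) (m n : nat) (a : 'I_m -> 'cV[R]_n)
    (w : 'rV[R]_m) : 'M[R]_n :=
  \sum_i w 0 i *: (a i *m (a i)^T).

Lemma mxtrace_moment (R : realType) m n r (a : 'I_m -> 'cV[R]_n)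
    (w : 'rV[R]_m) (Y : 'M[R]_(n, r)) :
  \tr (Y^T *m moment_mx a w *m Y) = \sum_i w 0 i * enorm (Y^T *m a i) ^+ 2.
Proof.
rewrite /moment_mx mulmx_sumr mulmx_suml raddf_sum; apply: eq_bigr => i _ /=.
rewrite -scalemxAr -scalemxAl mxtraceZ; congr (_ * _).
rewrite (mulmxA _ (a i)) -mulmxA mxtrace_mulC sqr_enormE trmx_mul trmxK.
by rewrite [LHS]/mxtrace big_ord1.
Qed.

Lemma mul_mx_design (R : realType) m n r (a : 'I_m -> 'cV[R]_n)
    (X : 'M[R]_(r, m)) :
  X *m design_mx a = \sum_i col i X *m (a i)^T.
Proof.
apply/matrixP => p q; rewrite mxE summxE; apply: eq_bigr => i _.
by rewrite !mxE big_ord1 !mxE.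
Qed.

Lemma mxtrace_mul_design (R : realType) m n r (a : 'I_m -> 'cV[R]_n)
    (X : 'M[R]_(r, m)) (Y : 'M[R]_(n, r)) :
  \tr (X *m design_mx a *m Y) = \sum_i ((col i X)^T *m (Y^T *m a i)) 0 0.
Proof.
rewrite mul_mx_design mulmx_suml raddf_sum; apply: eq_bigr => i _ /=.
rewrite -mulmxA mxtrace_mulC -mxtrace_tr !trmx_mul trmxK.
by rewrite [LHS]/mxtrace big_ord1.
Qed.

Definition info_mx (R : realType) (m n : nat) (Sigma : 'M[R]_n)
    (a : 'I_m -> 'cV[R]_n) (s : R) (w : 'rV[R]_m) : 'M[R]_n :=
  invmx Sigma + s^-1 *: moment_mx a w.

Lemma mxtrace_info (R : realType) m n r (Sigma : 'M[R]_n)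
    (a : 'I_m -> 'cV[R]_n) (s : R) (w : 'rV[R]_m) (Y : 'M[R]_(n, r)) :
  \tr (Y^T *m info_mx Sigma a s w *m Y) =
  \tr (Y^T *m invmx Sigma *m Y) + s^-1 * \sum_i w 0 i * enorm (Y^T *m a i) ^+ 2.
Proof.
rewrite mulmxDr mulmxDl raddfD /= -scalemxAr -scalemxAl mxtraceZ.
by rewrite mxtrace_moment.
Qed.

Lemma sympd_info (R : realType) m n (Sigma : 'M[R]_n)
    (a : 'I_m -> 'cV[R]_n) (s : R) (w : 'rV[R]_m) :
  sympd Sigma -> 0 < s -> (forall i, 0 <= w 0 i) ->
  sympd (info_mx Sigma a s w).
Proof.
move=> /sympd_invmx[Si_sym Si_gt0] s_gt0 w_ge0; split=> [|x x_neq0].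
  rewrite linearD linearZ /= Si_sym; congr (_ + _ *: _).
  rewrite linear_sum; apply: eq_bigr => i _ /=.
  by rewrite linearZ /= trmx_mul trmxK.
have tr11 (M : 'M[R]_1) : M 0 0 = \tr M by rewrite [RHS]/mxtrace big_ord1.
rewrite tr11 mxtrace_info -tr11 ltr_pwDl ?Si_gt0 // mulr_ge0 //.
  by rewrite invr_ge0 ltW.
by apply: sumr_ge0 => i _; rewrite mulr_ge0 ?sqr_ge0.
Qed.

(** * The two inequalities between the objectives *)

Section Duality.
Variables (R : realType) (m n r N : nat) (Sigma : 'M[R]_n) (K : 'M[R]_(n, r)).
Variables (a : 'I_m -> 'cV[R]_n) (sigma : R).
Hypotheses (N_gt0 : (0 < N)%N) (Sigma_pd : sympd Sigma) (sigma_gt0 : 0 < sigma).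

Local Notation s := (sigma ^+ 2 / N%:R).
Local Notation lasso := (lasso_obj N Sigma K a sigma).
Local Notation bayes := (bayes_obj N Sigma K a sigma).
Local Notation M := (info_mx Sigma a s).

Let s_gt0 : 0 < s.
Proof. by rewrite divr_gt0 ?exprn_gt0 ?ltr0n. Qed.

Lemma bayes_objE w : bayes w = \tr (K^T *m (invmx (M w) *m K)).
Proof. by rewrite mulmxA /info_mx invf_div. Qed.

Lemma lasso_objE X : lasso X =
  \tr ((X *m design_mx a - K^T) *m Sigma *m (X *m design_mx a - K^T)^T)
  + s * (\sum_i enorm (col i X)) ^+ 2.
Proof. by rewrite /lasso_obj sqr_fnorm_sqrtmx. Qed.

(** Weak duality at Y = M(w)^-1 K.  The hypothesis forces L to be the sum of
    the column norms; written as a product, it also covers X = 0, with L = 0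
    and any design w. *)
Lemma bayes_le_lasso X w L : simplex R m w ->
  (forall i, enorm (col i X) = L * w 0 i) -> bayes w <= lasso X.
Proof.
move=> [w_ge0 w_sum1] Xw.
have M_pd : sympd (M w) by apply: sympd_info.
have M_unit := sympd_unitmx M_pd.
pose Y := invmx (M w) *m K.
have KE : K = M w *m Y by rewrite mulKVmx.
have YMY : \tr (Y^T *m M w *m Y) = \tr (K^T *m Y).
  by rewrite -mulmxA -KE -mxtrace_tr trmx_mul trmxK.
rewrite bayes_objE lasso_objE -/Y.
have sum_norm : \sum_i enorm (col i X) = L.
  by rewrite (eq_bigr _ (fun i _ => Xw i)) -mulr_sumr w_sum1 mulr1.
rewrite sum_norm.
have := mxtrace_young (K^T - X *m design_mx a) Y Sigma_pd.
rewrite mulmxBl raddfB /=.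
rewrite -(opprB _ K^T) linearN /= mulmxN !mulNmx opprK.
have : 2 * \tr (X *m design_mx a *m Y) <=
       s * L ^+ 2 + s^-1 * \sum_i w 0 i * enorm (Y^T *m a i) ^+ 2.
  rewrite mxtrace_mul_design mulr_sumr.
  have -> : s * L ^+ 2 = s * L ^+ 2 * \sum_i w 0 i by rewrite w_sum1 mulr1.
  rewrite [s * _ * _]mulr_sumr [s^-1 * _]mulr_sumr -big_split.
  apply: ler_sum => i _ /=.
  (* A zero weight forces x_i = 0; a positive one allows c = s / w_i. *)
  have [wi0|wi_neq0] := eqVneq (w 0 i) 0.
    have /enorm_eq0 -> : enorm (col i X) = 0 by rewrite Xw wi0 mulr0.
    by rewrite wi0 trmx0 mul0mx mxE !(mul0r, mulr0) addr0.
  have wi_gt0 : 0 < w 0 i by rewrite lt_def wi_neq0 w_ge0.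
  apply: le_trans (dot_young _ _ (divr_gt0 s_gt0 wi_gt0)) _.
  rewrite Xw le_eqVlt; apply/orP; left; apply/eqP.
  by field; rewrite wi_neq0 ?gt_eqF ?ltr0n.
have := mxtrace_info Sigma a s w Y; rewrite YMY.
lra.
Qed.

(** The ridge solution X has residual X A - K^T = - Y^T Sigma^-1, so the two
    terms of its objective are compared one by one with the two terms of
    tr(Y^T M(w) Y), which is the Bayes objective; the first terms agree, and
    convexity compares the second ones. *)
Lemma lasso_le_bayes w : simplex R m w -> exists X, lasso X <= bayes w.
Proof.
move=> [w_ge0 w_sum1].
have M_pd : sympd (M w) by apply: sympd_info.
have M_unit := sympd_unitmx M_pd.
have [Si_sym _] := sympd_invmx Sigma_pd.
have S_unit := sympd_unitmx Sigma_pd.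
pose Y := invmx (M w) *m K.
have KE : K = M w *m Y by rewrite mulKVmx.
have YMY : \tr (Y^T *m M w *m Y) = \tr (K^T *m Y).
  by rewrite -mulmxA -KE -mxtrace_tr trmx_mul trmxK.
(* the solution of the ridge regression with penalties s / w_i *)
pose X : 'M[R]_(r, m) := \matrix_(p, i) (w 0 i / s * (Y^T *m a i) p 0).
have colX i : col i X = (w 0 i / s) *: (Y^T *m a i).
  by apply/colP => p; rewrite !mxE.
exists X; rewrite bayes_objE lasso_objE -/Y -YMY mxtrace_info.
have XA : X *m design_mx a = s^-1 *: (Y^T *m moment_mx a w).
  rewrite mul_mx_design mulmx_sumr scaler_sumr; apply: eq_bigr => i _.
  by rewrite colX -scalemxAl -scalemxAr scalerA mulmxA mulrC.
have -> : X *m design_mx a - K^T = - (Y^T *m invmx Sigma).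
  have -> : K^T = Y^T *m M w by rewrite [in LHS]KE trmx_mul M_pd.1.
  rewrite XA mulmxDr -scalemxAr.
  by rewrite opprD addrA addrAC subrr add0r.
rewrite [(- _)^T]linearN /= mulmxN !mulNmx opprK mulmxKV //.
rewrite (trmx_mul Y^T) trmxK Si_sym.
rewrite mulmxA lerD2l.
have -> : \sum_i enorm (col i X) = s^-1 * \sum_i w 0 i * enorm (Y^T *m a i).
  rewrite mulr_sumr; apply: eq_bigr => i _.
  rewrite colX enormZ; last by rewrite divr_ge0 // ltW.
  by rewrite [w 0 i / s]mulrC mulrA.
have scale mu : s * (s^-1 * mu) ^+ 2 = s^-1 * mu ^+ 2.
  by rewrite expr2 mulrA mulVKf ?gt_eqF // mulrCA expr2.
rewrite scale ler_pM2l ?invr_gt0 //.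
exact: sqr_mean_le.
Qed.

(** For any design w', [lasso_le_bayes] provides an X' such that
    bayes w <= lasso X <= lasso X' <= bayes w'. *)
Lemma bayes_optimal_of_lasso X w L :
  is_minimizer [set: 'M[R]_(r, m)] lasso X ->
  simplex R m w -> (forall i, enorm (col i X) = L * w 0 i) ->
  bayes_optimal N Sigma K a sigma w /\ bayes w = lasso X.
Proof.
move=> [_ X_min] w_simplex Xw.
have w_le := bayes_le_lasso w_simplex Xw.
have bayes_ge w' : simplex R m w' -> lasso X <= bayes w'.
  by move=> /lasso_le_bayes[X']; exact/le_trans/X_min.
split; last by apply/eqP; rewrite eq_le w_le bayes_ge.
by split=> // w' /bayes_ge; exact: le_trans.
Qed.

End Duality.

(** * Existence of a minimizer of the regularized problem *)

Lemma continuous_sum (R : realType) (T : topologicalType) k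
    (F : 'I_k -> T -> R) :
  (forall i, continuous (F i)) -> continuous (fun t => \sum_i F i t).
Proof.
move=> F_cont; apply: continuous_big => [|i _]; last exact: F_cont.
exact: add_continuous.
Qed.

(** The matrix is flattened to a row vector because [rV_compact] provides
    compact boxes of row vectors. *)
Lemma continuous_lasso_obj (R : realType) (m n r N : nat) (Sigma : 'M[R]_n)
    (K : 'M[R]_(n, r)) (a : 'I_m -> 'cV[R]_n) (sigma : R) :
  continuous (fun v : 'rV[R]_(r * m) => lasso_obj N Sigma K a sigma (vec_mx v)).
Proof.
have entry p i : continuous (fun v : 'rV[R]_(r * m) => vec_mx v p i).
  move=> v; under eq_fun do rewrite mxE; exact: coord_continuous.
have sqr_cont (f : 'rV[R]_(r * m) -> R) :
    continuous f -> continuous (fun v => f v ^+ 2).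
  move=> f_cont v; apply: (@continuous_comp _ _ _ f (fun x => x ^+ 2)).
    exact: f_cont.
  exact: exprn_continuous.
have sqrt_cont (f : 'rV[R]_(r * m) -> R) :
    continuous f -> continuous (fun v => Num.sqrt (f v)).
  move=> f_cont v; apply: (@continuous_comp _ _ _ f Num.sqrt).
    exact: f_cont.
  exact: sqrt_continuous.
have add_cont (f g : 'rV[R]_(r * m) -> R) :
    continuous f -> continuous g -> continuous (fun v => f v + g v).
  move=> f_cont g_cont v; exact: (continuousD (f_cont v) (g_cont v)).
have scale_cont (f : 'rV[R]_(r * m) -> R) c :
    continuous f -> continuous (fun v => c * f v).
  move=> f_cont v; exact: (continuousM (@cst_continuous _ _ c v) (f_cont v)).
have mul_cont p q (F : 'rV[R]_(r * m) -> 'M[R]_(r, p)) (B : 'M[R]_(p, q)) :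
    (forall i j, continuous (fun v => F v i j)) ->
    forall i j, continuous (fun v => (F v *m B) i j).
  move=> F_cont i j; under eq_fun do rewrite mxE.
  apply: continuous_sum => k; under eq_fun do rewrite mulrC.
  exact/scale_cont.
rewrite /lasso_obj /fnorm /enorm; apply/add_cont.
  apply/sqr_cont/sqrt_cont; do 2! apply: continuous_sum => ?.
  apply/sqr_cont/mul_cont => i j; under eq_fun do rewrite mxE.
  apply/add_cont; first exact: mul_cont.
  exact: cst_continuous.
apply/scale_cont/sqr_cont; apply: continuous_sum => i; apply/sqrt_cont.
apply: continuous_sum => p; apply/sqr_cont.
under eq_fun do rewrite mxE.
exact: entry.
Qed.

(** The penalty dominates s times the square of each entry, so every X outside
    the box of half-width B = sqrt (f 0 / s) does no better than 0, and it
    suffices to minimize over this compact box. *)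
Lemma lasso_minimizer_exists (R : realType) (m n r N : nat) (Sigma : 'M[R]_n)
    (K : 'M[R]_(n, r)) (a : 'I_m -> 'cV[R]_n) (sigma : R) :
  (0 < N)%N -> 0 < sigma ->
  exists X, is_minimizer [set: 'M[R]_(r, m)] (lasso_obj N Sigma K a sigma) X.
Proof.
move=> N_gt0 sigma_gt0; pose f := lasso_obj N Sigma K a sigma.
pose s := sigma ^+ 2 / N%:R.
have s_gt0 : 0 < s by rewrite divr_gt0 ?exprn_gt0 ?ltr0n.
pose B := Num.sqrt (f 0 / s).
have entry_le (X : 'M[R]_(r, m)) p i : s * X p i ^+ 2 <= f X.
  apply: (@le_trans _ _ (s * (\sum_i enorm (col i X)) ^+ 2)); last first.
    by rewrite lerDr sqr_ge0.
  rewrite ler_pM2l // -[X p i ^+ 2]real_normK ?num_real //.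
  rewrite lerXn2r ?nnegrE //; first by apply: sumr_ge0 => *; exact: enorm_ge0.
  rewrite (bigD1 i) //= -sqrtr_sqr.
  apply: ler_wpDr; first by apply: sumr_ge0 => *; exact: enorm_ge0.
  rewrite ler_sqrt; last by apply: sumr_ge0 => *; exact: sqr_ge0.
  rewrite (bigD1 p) //= mxE lerDl.
  by apply: sumr_ge0 => *; exact: sqr_ge0.
pose box := [set v : 'rV[R]_(r * m) | forall k, `[- B, B]%classic (v ord0 k)].
have box_compact : compact box.
  apply: (@rV_compact _ _ (fun=> `[- B, B]%classic)) => k.
  exact: segment_compact.
have box0 : box 0.
  by move=> k; rewrite mxE /= in_itv /= oppr_le0 sqrtr_ge0.
have outside (X : 'M[R]_(r, m)) : ~ box (mxvec X) -> f 0 <= f X.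
  apply: contra_notP => /negP; rewrite -ltNge => fX_lt k /=.
  case/mxvec_indexP: k => p i; rewrite mxvecE in_itv /= -ler_norml.
  rewrite -sqrtr_sqr ler_sqrt; last first.
    rewrite divr_ge0 ?(ltW s_gt0) // (le_trans _ (entry_le 0 p i)) //.
    by rewrite mulr_ge0 ?sqr_ge0 // ltW.
  by rewrite ler_pdivlMr // mulrC (le_trans (entry_le X p i)) ?ltW.
have [c _ c_min] := compact_EVT_min (ex_intro _ 0 box0) box_compact
  (continuous_subspaceT (@continuous_lasso_obj R m n r N Sigma K a sigma)).
exists (vec_mx c); split=> // X _.
have [X_in|X_out] := pselect (box (mxvec X)).
  by have := c_min _ (mem_set X_in); rewrite mxvecK.
apply: le_trans (outside _ X_out).
by have := c_min _ (mem_set box0); rewrite linear0.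
Qed.

(** * Designs proportional to the column norms *)

Lemma normalized_simplex (R : realType) m r (X : 'M[R]_(r, m))
    (w := \row_i (enorm (col i X) / \sum_j enorm (col j X))) :
  0 < \sum_j enorm (col j X) ->
  simplex R m w /\
  forall i, enorm (col i X) = (\sum_j enorm (col j X)) * w 0 i.
Proof.
move=> L_gt0; split; last by move=> i; rewrite mxE mulrC divfK ?gt_eqF.
split=> [i|]; first by rewrite mxE divr_ge0 ?enorm_ge0 ?ltW.
under eq_bigr do rewrite mxE.
by rewrite -mulr_suml divff ?gt_eqF.
Qed.

(** When all the column norms vanish, L = 0 and any vertex of the simplex
    will do. *)
Lemma proportional_design_exists (R : realType) m r (X : 'M[R]_(r, m)) :
  (0 < m)%N ->
  exists w L, simplex R m w /\ forall i, enorm (col i X) = L * w 0 i.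
Proof.
move=> m_gt0; have [L_gt0|L_le0] := ltP 0 (\sum_j enorm (col j X)).
  by have := normalized_simplex L_gt0; eexists; eexists; eassumption.
exists (delta_mx 0 (Ordinal m_gt0)), 0; split; last first.
  have L_ge0 : 0 <= \sum_j enorm (col j X).
    by apply: sumr_ge0 => j _; exact: enorm_ge0.
  have /eqP : \sum_j enorm (col j X) = 0 by apply/le_anti/andP.
  rewrite psumr_eq0 => [/allP X0 i|j _]; last exact: enorm_ge0.
  by rewrite mul0r; apply/eqP/X0; rewrite mem_index_enum.
split=> [i|]; first by rewrite mxE ler0n.
rewrite (bigD1 (Ordinal m_gt0)) //= mxE !eqxx big1 ?addr0 // => i /negbTE i_neq.
by rewrite mxE i_neq andbF.
Qed.

Theorem proposition2p1 (R : realType) (m n r N : nat) (Sigma : 'M[R]_n)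
    (K : 'M[R]_(n, r)) (a : 'I_m -> 'cV[R]_n) (sigma : R)
    (m_gt0 : (0 < m)%N) (N_gt0 : (0 < N)%N)
    (Sigma_pd : sympd Sigma) (sigma_gt0 : 0 < sigma) :
  (exists rho : R,
      is_min_value [set: 'M[R]_(r, m)] (lasso_obj N Sigma K a sigma) rho /\
      is_min_value (simplex R m) (bayes_obj N Sigma K a sigma) rho) /\
  (forall X : 'M[R]_(r, m),
      is_minimizer [set: 'M[R]_(r, m)] (lasso_obj N Sigma K a sigma) X ->
      0 < \sum_j enorm (col j X) ->
      bayes_optimal N Sigma K a sigma
        (\row_i (enorm (col i X) / \sum_j enorm (col j X)))).
Proof.
split=> [|X X_min /normalized_simplex[w_simplex Xw]]; last first.
  by have [] :=
    bayes_optimal_of_lasso N_gt0 Sigma_pd sigma_gt0 X_min w_simplex Xw.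
have [X X_min] := lasso_minimizer_exists Sigma K a N_gt0 sigma_gt0.
have [w [L [w_simplex Xw]]] := proportional_design_exists X m_gt0.
exists (lasso_obj N Sigma K a sigma X); split; first by exists X.
by exists w; exact: bayes_optimal_of_lasso X_min w_simplex Xw.
Qed.
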